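(* Let $n$ be a positive integer and let $S=S_1\cup S_2\subseteq T_{8n}\setminus\{e\}$ be nonempty with $S=S^{-1}$, where $S_1\subseteq \langle a\rangle\cup\langle a\rangle b^2$ and $S_2\subseteq\langle a\rangle b\cup\langle a\rangle b^3$. Then the Cayley graph $\mathrm{Cay}(T_{8n},S)$ is integral if and only if the following conditions hold for all $j=0,1,\dots,7$ and all $k,h=1,2,\dots,n-1$: (1) $\chi_j(S)$ is an integer; (2) $\varphi_k(S_1)$ and $\varphi_k(S_1^2)+\varphi_k(S_2^2)$ are integers; (3) $\Delta_{\varphi_k}(S)=2\left(\varphi_k(S_1^2)+\varphi_k(S_2^2)\right)-\left(\varphi_k(S_1)\right)^2$ is a perfect square; (4) $\psi_h(S_1)$ and $\psi_h(S_1^2)+\psi_h(S_2^2)$ are integers; (5) $\Delta_{\psi_h}(S)=2\left(\psi_h(S_1^2)+\psi_h(S_2^2)\right)-\left(\psi_h(S_1)\right)^2$ is a perfect square.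
   Context: $T_{8n}=\langle a,b\mid a^{2n}=b^8=e,\ a^n=b^4,\ b^{-1}ab=a^{-1}\rangle$ is a group of order $8n$; its elements are $a^r b^s$ with $0\le r\le 2n-1$, $0\le s\le 3$ (each written uniquely in this form). For a finite group $G$ with identity $e$ and a nonempty $S\subseteq G\setminus\{e\}$ with $S=S^{-1}$, $\mathrm{Cay}(G,S)$ is the graph with vertex set $G$ in which $x,y$ are adjacent iff $xy^{-1}\in S$. A graph is integral if all eigenvalues of its adjacency matrix are integers. A perfect square means the square of an integer. Let $\omega=\exp(\pi\mathbf i/4)$, $\varepsilon=\exp(2\pi\mathbf i/n)$, $\xi=\exp(\pi\mathbf i/n)$, $\mathbf i^2=-1$. The characters $\chi_j$ ($0\le j\le 7$), $\varphi_k$ ($1\le k\le n-1$), $\psi_h$ ($1\le h\le n-1$) of $T_{8n}$ have the following values ($0\le r\le 2n-1$). If $n$ is odd: $\chi_j(a^rb^s)=(-1)^{rj}\omega^{sj}$ for $s=0,1,2,3$; $\varphi_k(a^r)=\varepsilon^{kr}+\varepsilon^{-kr}$, $\varphi_k(a^rb^2)=(-1)^k(\varepsilon^{kr}+\varepsilon^{-kr})$, $\varphi_k(a^rb)=\varphi_k(a^rb^3)=0$; $\psi_h(a^r)=(-1)^{rh+r}(\xi^{hr}+\xi^{-hr})$, $\psi_h(a^rb^2)=\mathbf i(-1)^{rh+r}(\xi^{hr}+\xi^{-hr})$, $\psi_h(a^rb)=\psi_h(a^rb^3)=0$. If $n$ is even: $\chi_j(a^rb^s)=\omega^{sj}$ for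 $j\in\{0,2,4,6\}$ and $\chi_j(a^rb^s)=(-1)^r\omega^{s(j-1)}$ for $j\in\{1,3,5,7\}$, $s=0,1,2,3$; $\varphi_k(a^r)=\xi^{kr}+\xi^{-kr}$, $\varphi_k(a^rb^2)=\xi^{kr}+\xi^{-kr}$ for $k$ even and $\mathbf i(\xi^{kr}+\xi^{-kr})$ for $k$ odd, $\varphi_k(a^rb)=\varphi_k(a^rb^3)=0$; $\psi_h(a^r)=\xi^{hr}+\xi^{-hr}$, $\psi_h(a^rb^2)=-(\xi^{hr}+\xi^{-hr})$ for $h$ even and $-\mathbf i(\xi^{hr}+\xi^{-hr})$ for $h$ odd, $\psi_h(a^rb)=\psi_h(a^rb^3)=0$. For a character $\chi$ and subsets $A,B$ of the group: $\chi(\emptyset)=0$, $\chi(A)=\sum_{x\in A}\chi(x)$, $\chi(AB)=\sum_{x\in A,\,y\in B}\chi(xy)$ (sum over all pairs, i.e. with multiplicity), and $\chi(A^2)=\chi(AA)$. *)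

(* Defs.v *)
From HB Require Import structures.
From mathcomp Require Import all_boot all_order all_algebra all_fingroup.
From mathcomp Require Import complex.
From mathcomp Require Import reals trigo.

Set Implicit Arguments.
Unset Strict Implicit.
Unset Printing Implicit Defensive.

Import Order.TTheory GRing.Theory Num.Theory.
Local Open Scope ring_scope.
Local Open Scope complex_scope.

(* [G \isog Grp (...)] is MathComp's "G is the group with this presentation".
   As it hides the generators, we also require that the given a and b satisfy
   the relations and generate the group; together this says exactly that
   x |-> a, y |-> b is an isomorphism from the presented group onto gT. *)
Definition is_T8n (n : nat) (gT : finGroupType) (a b : gT) : Prop :=
  [/\ ([set: gT] \isog Grp (x : y :
        x ^+ (2 * n) = y ^+ 8 = 1, x ^+ n = y ^+ 4, x ^ y = x^-1))%g,
      <<[set a; b]>>%g = [set: gT]%g,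
      (a ^+ (2 * n) = 1)%g /\ (b ^+ 8 = 1)%g,
      (a ^+ n = b ^+ 4)%g
    & (b^-1 * a * b = a^-1)%g].

Definition cayley_rel (gT : finGroupType) (S : {set gT}) : rel gT :=
  fun x y => (x * y^-1)%g \in S.

Definition adjmx (F : nzRingType) (T : finType) (e : rel T) : 'M[F]_#|T| :=
  \matrix_(i, j) (e (enum_val i) (enum_val j))%:R.

Section Complex.
Variable R : realType.

Definition is_integer (z : R[i]) : Prop := exists m : int, z = m%:~R.

Definition is_perfect_square (z : R[i]) : Prop :=
  exists m : int, z = (m ^+ 2)%:~R.

Definition integral_graph (T : finType) (e : rel T) : Prop :=
  forall z : R[i], eigenvalue (adjmx R[i] e) z -> is_integer z.

(* exp(i t) for real t *)
Definition expi (t : R) : R[i] := cos t +i* sin t.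

Definition omega : R[i] := expi (pi / 4%:R).
Definition epsilon (n : nat) : R[i] := expi (2%:R * pi / n%:R).
Definition xi (n : nat) : R[i] := expi (pi / n%:R).

Section Values.
Variable n : nat.

(* Values of the characters at a^r b^s, for r < 2n and s < 4. *)
Definition chi_val (j r s : nat) : R[i] :=
  if odd n then (-1) ^+ (r * j) * omega ^+ (s * j)
  else if odd j then (-1) ^+ r * omega ^+ (s * (j - 1))
  else omega ^+ (s * j).

Definition phi_val (k r s : nat) : R[i] :=
  if odd n then
    let c := epsilon n ^+ (k * r) + epsilon n ^- (k * r) in
    match s with
    | 0 => c
    | 2 => (-1) ^+ k * c
    | _ => 0
    end
  else
    let c := xi n ^+ (k * r) + xi n ^- (k * r) in
    match s with
    | 0 => c
    | 2 => if odd k then 'i * c else c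
    | _ => 0
    end.

Definition psi_val (h r s : nat) : R[i] :=
  let c := xi n ^+ (h * r) + xi n ^- (h * r) in
  if odd n then
    match s with
    | 0 => (-1) ^+ (r * h + r) * c
    | 2 => 'i * (-1) ^+ (r * h + r) * c
    | _ => 0
    end
  else
    match s with
    | 0 => c
    | 2 => if odd h then - 'i * c else - c
    | _ => 0
    end.

Section Characters.
Variables (gT : finGroupType) (a b : gT).

(* The function x |-> f r s where x = a^r b^s, 0 <= r < 2n, 0 <= s < 4; the
   value 0 is never used when [is_T8n n a b], as every x then has a unique
   such expression. *)
Definition on_normal_form (f : nat -> nat -> R[i]) (x : gT) : R[i] :=
  if [pick p : 'I_(2 * n) * 'I_4 | x == (a ^+ p.1 * b ^+ p.2)%g] is Some p
  then f p.1 p.2 else 0.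

Definition chi (j : nat) : gT -> R[i] := on_normal_form (chi_val j).
Definition phi (k : nat) : gT -> R[i] := on_normal_form (phi_val k).
Definition psi (h : nat) : gT -> R[i] := on_normal_form (psi_val h).

End Characters.
End Values.

Section Sums.
Variable gT : finGroupType.
Implicit Types (f : gT -> R[i]) (A B : {set gT}).

Definition char_sum f A : R[i] := \sum_(x in A) f x.

(* With multiplicity: this is not the sum over the product set. *)
Definition char_sum2 f A B : R[i] :=
  \sum_(x in A) \sum_(y in B) f (x * y)%g.

(* f(S1^2) + f(S2^2) *)
Definition sq_sum f (S1 S2 : {set gT}) : R[i] :=
  char_sum2 f S1 S1 + char_sum2 f S2 S2.

Definition Delta f (S1 S2 : {set gT}) : R[i] :=
  2%:R * sq_sum f S1 S2 - char_sum f S1 ^+ 2.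

End Sums.
End Complex.

(* Main.v *)
Require Import Defs.
From HB Require Import structures.
From mathcomp Require Import all_boot all_order all_algebra all_fingroup.
From mathcomp Require Import complex.
From mathcomp Require Import reals trigo.
From mathcomp Require Import zify ring.

Set Implicit Arguments.
Unset Strict Implicit.
Unset Printing Implicit Defensive.

(** An eigenvector of Cay(G, S) for z is a function f on G with
    sum_(s in S) f(s y) = z f(y), and the space of these is stable under right
    translations.  Projecting f onto an eigenspace of the translation by a, of
    eigenvalue zeta, and then onto one of the translation by b if zeta^2 = 1, by
    b^2 otherwise, shows that z is either the sum over S of a linear character
    or an eigenvalue of the sum M over S of the 2-dimensional representation
    induced from a |-> zeta, b^2 |-> gamma; conversely all of these occur.  As
    S1 contributes the diagonal and S2 the antidiagonal entries of M, the traces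
    of M and M^2 are f(S1) and f(S1^2) + f(S2^2) for the character f of the
    representation, and the discriminant of M is Delta_f(S).  A parity argument
    then shows that the eigenvalues of M are integers iff these two traces are
    integers and the discriminant is a perfect square. *)

(** * A permutation model of the presented group, of order at least [8n] *)

Section Model.
Import GRing.Theory.
Local Open Scope group_scope.
Variable n : nat.
Hypothesis n_gt0 : (0 < n)%N.

Let Q := ('Z_(2 * n) * 'I_4)%type.

(* Right multiplication by a and by b on the normal forms a^r b^s. *)
Definition act_a (p : Q) : Q :=
  (if odd p.2 then p.1 - 1 else p.1 + 1, p.2)%R.
Definition act_b (p : Q) : Q :=
  (if p.2 == ord_max then p.1 + n%:R else p.1, ordS p.2)%R.

Let dn_gt1 : (1 < 2 * n)%N.
Proof. by rewrite mul2n -addnn; case: n n_gt0 => // m _; rewrite addnS. Qed.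

Let nn0 : (n%:R + n%:R = 0 :> 'Z_(2 * n))%R.
Proof. by rewrite -natrD addnn -mul2n pchar_Zp. Qed.

Lemma act_a_inj : injective act_a.
Proof.
move=> [r s] [r' s']; rewrite /act_a /= => -[+ eq_s].
by rewrite eq_s; case: (odd s') => [/addIr|/addIr] ->.
Qed.

Lemma act_b_inj : injective act_b.
Proof.
move=> [r s] [r' s']; rewrite /act_b /= => -[+ eq_s].
have {}eq_s : s = s' by apply/ordS_inj/val_inj.
by rewrite eq_s; case: eqP => _ => [/addIr|] ->.
Qed.

Let alpha := perm act_a_inj.
Let beta := perm act_b_inj.

Lemma alphaX k r (s : 'I_4) :
  (alpha ^+ k) (r, s) = (if odd s then r - k%:R else r + k%:R, s)%R.
Proof.
elim: k => [|k IHk]; first by rewrite perm1 subr0 addr0 if_same.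
rewrite expgSr permM {}IHk permE /act_a /=; case: (odd s).
  by rewrite -addrA -opprD -natr1.
by rewrite -addrA -natr1.
Qed.

Lemma betaX k r : (k < 4)%N -> (beta ^+ k) (r, ord0) = (r, inord k).
Proof.
elim: k => [|k IHk] lek.
  by rewrite perm1; congr (_, _); apply/val_inj; rewrite /= inordK.
rewrite expgSr permM IHk ?permE /act_b /=; last exact: ltnW.
rewrite -val_eqE /= inordK ?(ltnW lek) // ltn_eqF //.
by congr (_, _); apply: val_inj; rewrite /= !inordK ?(ltnW lek) // modn_small.
Qed.

Lemma beta4 r (s : 'I_4) : (beta ^+ 4) (r, s) = (r + n%:R, s)%R.
Proof.
rewrite !expgS expg0 mulg1 !permM !permE /act_b /=.
by case: s => -[|[|[|[|//]]]] lts /=; congr (_, _); apply: val_inj.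
Qed.

Lemma model_relations :
  [/\ alpha ^+ (2 * n) = 1, beta ^+ 8 = 1, alpha ^+ n = beta ^+ 4
     & alpha ^ beta = alpha^-1].
Proof.
have eqab : alpha ^+ n = beta ^+ 4.
  apply/permP => -[r s]; rewrite alphaX beta4.
  case: (odd s) => //; congr (_ + _, _)%R; apply/eqP.
  by rewrite eq_sym -subr_eq0 opprK nn0.
have a2n : alpha ^+ (2 * n) = 1.
  by apply/permP => -[r s]; rewrite alphaX perm1 pchar_Zp // subr0 addr0 if_same.
split=> //.
  by rewrite (expgM beta 4 2) -eqab -expgM -[RHS]a2n; congr (_ ^+ _); exact: mulnC.
have aba : alpha * beta * alpha = beta.
  apply/permP => -[r s]; rewrite !permM !permE /act_a /act_b /=.
  case: s => -[|[|[|[|//]]]] lts //=; rewrite -?val_eqE /=; congr (_, _);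
    by rewrite ?addrK ?subrK // addrAC ?addrK ?subrK.
by apply: (mulIg alpha); rewrite mulVg conjgE -!mulgA mulgA in aba *; rewrite aba mulVg.
Qed.

Definition model := <[alpha]> <*> <[beta]>.

(** Evaluation at [(0, 0)], the normal form of the identity, maps the model onto all [8n] normal
    forms. *)
Lemma card_model : (8 * n <= #|model|)%N.
Proof.
pose ev (g : {perm Q}) : Q := g (0%R, ord0).
suff evT : ev @: model = setT.
  apply: leq_trans (leq_imset_card ev model).
  by rewrite evT cardsT card_prod !card_ord Zp_cast // mulnAC.
apply/setP => -[r s]; rewrite [RHS]inE; apply/imsetP.
(* Products of permutations act from left to right: [beta ^+ s] reaches [(0, s)], then [alpha] moves
   the first coordinate, backwards when [s] is odd. *)
exists (beta ^+ s * alpha ^+ (if odd s then - r else r)%R).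
  by rewrite groupM // mem_gen // inE mem_cycle ?orbT.
rewrite /ev permM betaX // inord_val alphaX.
by case: (odd s); rewrite (@natr_Zp (Zp_trunc (2 * n))) ?sub0r ?opprK ?add0r.
Qed.

End Model.

(** * Existence and uniqueness of the normal form [a^r b^s] *)

Section NormalForm.
Import GRing.Theory.
Local Open Scope group_scope.
Variables (n : nat) (gT : finGroupType) (a b : gT).
Hypotheses (n_gt0 : (0 < n)%N) (T8n_ab : is_T8n n a b).

Lemma T8n_a2n : a ^+ (2 * n) = 1. Proof. by case: T8n_ab => _ _ []. Qed.

Lemma T8n_b4 : b ^+ 4 = a ^+ n. Proof. by case: T8n_ab. Qed.

Lemma T8n_ab_comm : a * b = b * a^-1.
Proof. by case: T8n_ab => _ _ _ _ <-; rewrite !mulgA mulgV mul1g. Qed.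

(** [b] normalises [<a>], so the group is the product of the two cyclic groups; [b^4 = a^n] then
    brings the exponent of [b] below 4. *)
Lemma T8n_normal_form x :
  exists r s, [/\ (r < 2 * n)%N, (s < 4)%N & x = a ^+ r * b ^+ s].
Proof.
have dn_gt0 : (0 < 2 * n)%N by rewrite muln_gt0.
have: x \in <[a]> * <[b]>.
  rewrite -norm_joinEr; last first.
    rewrite norms_cycle conjgE T8n_ab_comm mulKg groupV; exact: cycle_id.
  by rewrite joing_idl joing_idr /joing; case: T8n_ab => _ -> _ _ _; rewrite inE.
case/imset2P => _ _ /cycleP[i ->] /cycleP[j ->] ->.
exists ((i + n * (j %/ 4)) %% (2 * n)), (j %% 4); split; rewrite ?ltn_mod //.
rewrite (expg_mod _ T8n_a2n) expgD expgM -T8n_b4 -mulgA -expgM -expgD.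
by rewrite mulnC -divn_eq.
Qed.

(** The model satisfies the relations, so the universal property of the presentation makes it a
    homomorphic image of the group. *)
Lemma T8n_card : (8 * n <= #|gT|)%N.
Proof.
have [a2n b8 eqab ab_inv] := model_relations n_gt0.
apply: leq_trans (card_model n_gt0) _; rewrite -cardsT.
case: T8n_ab => iso _ _ _ _.
suff: model n \homg [set: gT] by move/card_homg; apply: dvdn_leq; rewrite cardG_gt0.
rewrite iso; apply/existsP.
exists (perm (act_a_inj (n:=n)), perm (act_b_inj (n:=n))) => /=.
by rewrite a2n b8 eqab ab_inv !eqxx.
Qed.

(** The [8n] pairs of exponents cover a group of at least [8n] elements, so no two of them give the
    same element. *)
Lemma T8n_uniq r s r' s' :
  (r < 2 * n)%N -> (s < 4)%N -> (r' < 2 * n)%N -> (s' < 4)%N ->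
  a ^+ r * b ^+ s = a ^+ r' * b ^+ s' -> r = r' /\ s = s'.
Proof.
move=> ltr lts ltr' lts'.
pose f (p : 'I_(2 * n) * 'I_4) := a ^+ p.1 * b ^+ p.2.
suff f_inj : injective f.
  move=> eq_x.
  by have [] := f_inj (Ordinal ltr, Ordinal lts) (Ordinal ltr', Ordinal lts') eq_x.
suff /injectiveP : injectiveb f by [].
apply/card_uniqP/eqP; rewrite eqn_leq card_size /= size_image card_prod !card_ord mulnAC.
apply: leq_trans T8n_card _; rewrite -cardsT; apply/subset_leq_card/subsetP => x _.
have [i [j [lti ltj ->]]] := T8n_normal_form x.
by apply/codomP; exists (Ordinal lti, Ordinal ltj).
Qed.

End NormalForm.

(** * Multiplicative maps prescribed on the generators *)

Section Extension.
Import GRing.Theory.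
Local Open Scope ring_scope.
Variables (n : nat) (gT : finGroupType) (a b : gT).
Hypotheses (n_gt0 : (0 < n)%N) (T8n_ab : is_T8n n a b).
Variables (A : nzRingType) (D B : A).

(** The homomorphism taking [a] to [D] and [b] to [B], once these satisfy the relations. The ring
    [A] will be the complex numbers for linear characters and the 2 by 2 matrices for induced
    representations. The default 0 is never reached, since every element has a normal form. *)
Definition T8n_ext (x : gT) : A :=
  if [pick p : 'I_(2 * n) * 'I_4 | x == (a ^+ p.1 * b ^+ p.2)%g] is Some p
  then D ^+ p.1 * B ^+ p.2 else 0.

Hypotheses (D2n : D ^+ (2 * n) = 1) (DnB4 : D ^+ n = B ^+ 4)
  (DBD : D * B * D = B).

Lemma T8n_extE r s : T8n_ext (a ^+ r * b ^+ s)%g = D ^+ r * B ^+ s.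
Proof.
have dn_gt0 : (0 < 2 * n)%N by rewrite muln_gt0.
have ex_small i j : (i < 2 * n)%N -> (j < 4)%N ->
    T8n_ext (a ^+ i * b ^+ j)%g = D ^+ i * B ^+ j.
  move=> lti ltj; rewrite /T8n_ext; case: pickP => [[i' j'] /eqP /= eq_x|].
    by have [] := T8n_uniq n_gt0 T8n_ab lti ltj (ltn_ord _) (ltn_ord _) eq_x => -> ->.
  by move/(_ (Ordinal lti, Ordinal ltj)); rewrite eqxx.
have D_mod k : D ^+ (k %% (2 * n)) = D ^+ k.
  by rewrite [in RHS](divn_eq k (2 * n)) exprD (mulnC (k %/ _)%N) exprM D2n expr1n mul1r.
transitivity (T8n_ext (a ^+ ((r + n * (s %/ 4)) %% (2 * n)) * b ^+ (s %% 4))%g).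
  rewrite (expg_mod _ (T8n_a2n T8n_ab)) expgD expgM -(T8n_b4 T8n_ab) -mulgA.
  by rewrite -expgM -expgD mulnC -divn_eq.
rewrite ex_small ?ltn_mod // D_mod exprD exprM DnB4 -mulrA -exprM -exprD.
by rewrite mulnC -divn_eq.
Qed.

(** Modulo [2n] the exponent is the sign [(-1)^s]; written with natural numbers, the same rule can
    be stated in [A] without inverses. *)
Lemma T8n_bX_a s : (b ^+ s * a = a ^+ ((2 * n).-1 ^ s) * b ^+ s)%g.
Proof.
have ba : (b * a = a ^+ (2 * n).-1 * b)%g.
  have aba : (a * b * a = b)%g by rewrite (T8n_ab_comm T8n_ab) mulgKV.
  rewrite -[b in RHS]aba !mulgA -expgSr prednK ?muln_gt0 //.
  by rewrite (T8n_a2n T8n_ab) mul1g.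
have baX k : (b * a ^+ k = a ^+ ((2 * n).-1 * k) * b)%g.
  elim: k => [|k IHk]; first by rewrite muln0 mulg1 mul1g.
  by rewrite expgSr mulgA IHk -mulgA ba mulgA -expgD mulnSr.
elim: s => [|s IHs]; first by rewrite mul1g mulg1.
by rewrite expgS -mulgA IHs mulgA baX -mulgA -expnS.
Qed.

Lemma ext_BX_D s : B ^+ s * D = D ^+ ((2 * n).-1 ^ s) * B ^+ s.
Proof.
have BD : B * D = D ^+ (2 * n).-1 * B.
  by rewrite -[B in RHS]DBD !mulrA -exprSr prednK ?muln_gt0 // D2n mul1r.
have BDX k : B * D ^+ k = D ^+ ((2 * n).-1 * k) * B.
  elim: k => [|k IHk]; first by rewrite muln0 mulr1 mul1r.
  by rewrite exprSr mulrA IHk -mulrA BD mulrA -exprD mulnSr.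
elim: s => [|s IHs]; first by rewrite mul1r mulr1.
by rewrite exprS -mulrA IHs mulrA BDX -mulrA -expnS.
Qed.

Lemma T8n_ext1 : T8n_ext 1%g = 1.
Proof. by rewrite -[1%g]mulg1 -[X in (X * _)%g](expg0 a) (T8n_extE 0 0) mulr1. Qed.

Lemma T8n_exta : T8n_ext a = D.
Proof. by rewrite -[a]mulg1 (T8n_extE 1 0) mulr1. Qed.

Lemma T8n_extb : T8n_ext b = B.
Proof. by rewrite -[b]mul1g (T8n_extE 0 1) mul1r. Qed.

(** Every [y] is a word [a^r b^s], so it is enough to treat right multiplication by [a] and by
    [b]. *)
Lemma T8n_extM x y : T8n_ext (x * y)%g = T8n_ext x * T8n_ext y.
Proof.
have extMa z : T8n_ext (z * a)%g = T8n_ext z * D.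
  have [r [s [_ _ ->]]] := T8n_normal_form n_gt0 T8n_ab z.
  by rewrite -mulgA T8n_bX_a mulgA -expgD !T8n_extE exprD -!mulrA ext_BX_D.
have extMb z : T8n_ext (z * b)%g = T8n_ext z * B.
  have [r [s [_ _ ->]]] := T8n_normal_form n_gt0 T8n_ab z.
  by rewrite -mulgA -expgSr !T8n_extE exprSr mulrA.
have [r [s [_ _ ->]]] := T8n_normal_form n_gt0 T8n_ab y.
rewrite T8n_extE mulgA.
have -> : T8n_ext (x * a ^+ r * b ^+ s)%g = T8n_ext (x * a ^+ r)%g * B ^+ s.
  elim: s => [|s IHs]; first by rewrite mulg1 mulr1.
  by rewrite expgSr mulgA extMb IHs exprSr mulrA.
rewrite mulrA; congr (_ * _).
elim: r => [|r IHr]; first by rewrite mulg1 mulr1.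
by rewrite expgSr mulgA extMa IHr exprSr mulrA.
Qed.

End Extension.

(** * Eigenvalues of 2 by 2 matrices and their integrality *)

Section TwoByTwo.
Import GRing.Theory Num.Theory.
Local Open Scope ring_scope.

Lemma mulmx22 (A : pzSemiRingType) (M N : 'M[A]_2) i j :
  (M *m N) i j = M i 0 * N 0 j + M i 1 * N 1 j.
Proof.
by rewrite mxE big_ord_recl big_ord1; congr (_ + M i _ * N _ j); apply: val_inj.
Qed.

Lemma mxtrace22 (A : pzSemiRingType) (M : 'M[A]_2) : \tr M = M 0 0 + M 1 1.
Proof.
by rewrite /mxtrace big_ord_recl big_ord1; congr (_ + M _ _); apply: val_inj.
Qed.

Lemma ord2P (i : 'I_2) : i = 0 \/ i = 1.
Proof. by case: i => -[|[|//]] lti; [left|right]; apply: val_inj. Qed.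

Lemma matrix22P T (M N : 'M[T]_2) :
  M 0 0 = N 0 0 -> M 0 1 = N 0 1 -> M 1 0 = N 1 0 -> M 1 1 = N 1 1 -> M = N.
Proof. by move=> *; apply/matrixP => i j; case: (ord2P i) (ord2P j) => -> [] ->. Qed.

Lemma det22 (A : comPzRingType) (M : 'M[A]_2) :
  \det M = M 0 0 * M 1 1 - M 0 1 * M 1 0.
Proof.
rewrite (expand_det_row M 0) big_ord_recl big_ord1 /cofactor !det_mx11 !mxE /=.
rewrite expr0 mul1r expr1 mulN1r mulrN.
by congr (M _ _ * M _ _ - M _ _ * M _ _); apply: val_inj.
Qed.

(** Complete the square in four times the characteristic polynomial and use
    [2 det M = (tr M)^2 - tr (M^2)]; the right-hand side is the discriminant. *)
Lemma eigenvalue22 (C : numFieldType) (M : 'M[C]_2) z :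
  eigenvalue M z =
  ((2%:R * z - \tr M) ^+ 2 == 2%:R * \tr (M *m M) - \tr M ^+ 2).
Proof.
rewrite /eigenvalue /eigenspace kermx_eq0 row_free_unit unitmxE unitfE negbK det22.
rewrite !mxtrace22 !mulmx22 !mxE /= mulr0n mulr1n !subr0.
rewrite -subr_eq0 -(mulrI_eq0 _ (x := 4%:R)); last first.
  by apply/lregP; rewrite pnatr_eq0.
by rewrite -[in RHS]subr_eq0; congr (_ == 0); ring.
Qed.

Variable R : realType.
Local Notation C := R[i]%C.

Lemma eigenvalues22_integer (M : 'M[C]_2) :
  (forall z, eigenvalue M z -> is_integer z) <->
  [/\ is_integer (\tr M), is_integer (\tr (M *m M))
    & is_perfect_square (2%:R * \tr (M *m M) - \tr M ^+ 2)].
Proof.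
have n2 : (2%:R : C) != 0 by rewrite pnatr_eq0.
set t := \tr M; set q := \tr (M *m M); set d := 2%:R * q - t ^+ 2.
split=> [Mint | [[t' tE] [q' qE] [m dE]] z].
  have dsq : sqrtC d ^+ 2 = d by rewrite sqrtCK.
  (* The eigenvalues [p] and [p'] are [(t + sqrt d)/2] and [(t - sqrt d)/2], so [t], [q] and [d] are
     [p + p'], [p^2 + p'^2] and [(p - p')^2]. *)
  have [p pE] : is_integer ((t + sqrtC d) / 2%:R).
    apply: Mint; rewrite eigenvalue22 -/t -/q -/d -[X in _ == X]dsq.
    by rewrite mulrC divfK // addrAC subrr add0r.
  have [p' p'E] : is_integer ((t - sqrtC d) / 2%:R).
    apply: Mint; rewrite eigenvalue22 -/t -/q -/d -[X in _ == X]dsq.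
    by rewrite mulrC divfK // addrAC subrr add0r sqrrN.
  have tE : t = (p + p')%:~R by rewrite rmorphD /= -pE -p'E; field.
  have sE : sqrtC d = (p - p')%:~R by rewrite rmorphB /= -pE -p'E; field.
  have dE : d = ((p - p') ^+ 2)%:~R by rewrite -dsq sE rmorphXn.
  split; [by exists (p + p') | | by exists (p - p')].
  exists (p ^+ 2 + p' ^+ 2); apply: (mulfI n2).
  have -> : 2%:R * q = d + t ^+ 2 by rewrite /d subrK.
  by rewrite dE tE -rmorphXn -rmorphD -[2%:R]/(2%:~R) -rmorphM; congr _%:~R; ring.
rewrite eigenvalue22 -/t -/q -/d dE rmorphXn eqf_sqr.
(* As [m^2 + t'^2] is even, [m] and [t'] have the same parity, so [(t' + m)/2] and [(t' - m)/2] are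
   integers. *)
have parity : (m ^+ 2 = 2 * q' - t' ^+ 2)%R.
  by apply/(@intr_inj C); rewrite -dE /d qE tE rmorphB rmorphM rmorphXn.
have half (e : int) : e ^+ 2 = m ^+ 2 -> 2%:R * z - t = e%:~R -> is_integer z.
  move=> e2 zE; have : (2 %| e + t')%Z.
    have : (2 %| (e + t') ^+ 2)%Z.
      have -> : (e + t') ^+ 2 = 2 * (q' + e * t').
        by rewrite sqrrD e2 parity; ring.
      exact: dvdz_mulr.
    rewrite !dvdzE abszX Euclid_dvdX //.
    by case/andP.
  case/dvdzP => h hE; exists h; apply: (mulfI n2).
  by rewrite -[LHS](subrK t) zE tE -rmorphD hE rmorphM mulrC.
by case/orP => /eqP zE; [apply: (half m) | apply: (half (- m))];
  rewrite ?sqrrN ?zE ?rmorphN.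
Qed.

End TwoByTwo.

(** * Eigenvectors of the Cayley graph as functions on the group *)

Section CayleyEigenfunctions.
Import GRing.Theory Num.Theory.
Local Open Scope ring_scope.
Variables (gT : finGroupType) (S : {set gT}).

Definition cayley_eigenfun (C : nzRingType) (z : C) (f : gT -> C) : Prop :=
  forall y, \sum_(s in S) f (s * y)%g = z * f y.

Lemma cayley_eigenvalueP (C : fieldType) (z : C) :
  eigenvalue (adjmx C (cayley_rel S)) z <->
  exists2 f : gT -> C, cayley_eigenfun z f & exists x, f x != 0.
Proof.
have mulE (v : 'rV[C]_#|gT|) y :
    (v *m adjmx C (cayley_rel S)) 0 (enum_rank y) =
    \sum_(s in S) v 0 (enum_rank (s * y)%g).
  pose h (x : gT) := enum_rank (x * y)%g.
  have h_bij : {on predT, bijective h}.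
    exists (fun i => (enum_val i * y^-1)%g) => i _; rewrite /h ?enum_rankK ?mulgK //.
    by rewrite mulgKV enum_valK.
  rewrite mxE (reindex h) //= [RHS]big_mkcond; apply: eq_bigr => x _.
  rewrite mxE !enum_rankK /cayley_rel mulgK.
  by case: (x \in S); rewrite ?mulr1 ?mulr0.
split=> [/eigenvalueP[v vE v_neq0] | [f fE [x fx]]].
  exists (fun x => v 0 (enum_rank x)) => [y|].
    by rewrite -mulE vE mxE.
  have /rV0Pn[i vi] := v_neq0; exists (enum_val i); by rewrite enum_valK.
apply/eigenvalueP; exists (\row_i f (enum_val i)); last first.
  by apply/rV0Pn; exists (enum_rank x); rewrite mxE enum_rankK.
apply/rowP => i; rewrite -(enum_valK i) mulE !mxE enum_rankK -fE.
by apply: eq_bigr => s _; rewrite mxE enum_rankK.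
Qed.

(** A row eigenvector [u] of the sum over [S] yields the eigenfunction [y -> (u rho(y))_i]; choosing
    [i] with [u_i] nonzero makes it nonzero at 1. *)
Lemma hom_eigenfun (C : fieldType) m (rho : gT -> 'M[C]_m) (z : C) :
  rho 1%g = 1%:M -> {morph rho : x y / (x * y)%g >-> x *m y} ->
  eigenvalue (\sum_(s in S) rho s) z ->
  eigenvalue (adjmx C (cayley_rel S)) z.
Proof.
move=> rho1 rhoM /eigenvalueP[u uE /rV0Pn[i ui]]; apply/cayley_eigenvalueP.
exists (fun y => (u *m rho y) 0 i); last by exists 1%g; rewrite rho1 mulmx1.
move=> y; transitivity ((u *m (\sum_(s in S) rho s) *m rho y) 0 i); last first.
  by rewrite uE -scalemxAl mxE.
rewrite mulmx_sumr mulmx_suml summxE; apply: eq_bigr => s _.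
by rewrite rhoM mulmxA.
Qed.

(* Fourier projection onto the eigenspaces of the right translation by t:
   the N projections of f add up to N f, so one of them is nonzero at x0. *)
Lemma translation_eigenfun (C : numFieldType) N (w z : C) (t : gT) (f : gT -> C) x0 :
  N.-primitive_root w -> (t ^+ N = 1)%g -> cayley_eigenfun z f -> f x0 != 0 ->
  exists k (c : 'I_N -> C) (g : gT -> C),
    [/\ forall x, g x = \sum_(r < N) c r * f (x * t ^+ r)%g, (k < N)%N, g x0 != 0,
        cayley_eigenfun z g & forall x, g (x * t)%g = w ^+ k * g x].
Proof.
move=> prim_w tN fE fx0.
have N_gt0 := prim_order_gt0 prim_w; have wN := prim_expr_order prim_w.
have w_neq0 : w != 0 by rewrite (prim_root_eq0 prim_w) -lt0n.
pose c (k r : nat) : C := w ^- (k * r).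
pose g k x := \sum_(r < N) c k r * f (x * t ^+ r)%g.
have sum_g : \sum_(k < N) g k x0 = N%:R * f x0.
  rewrite exchange_big (bigD1 (Ordinal N_gt0)) //= [X in _ + X]big1 ?addr0.
    by rewrite -mulr_suml mulg1; under eq_bigr do rewrite /c muln0 invr1;
       rewrite sumr_const card_ord.
  (* For nonzero [r] the sum of [w^(-kr)] over [k] is geometric with ratio different from 1, and
     vanishes since [w^N = 1]. *)
  move=> r r_neq0; rewrite -mulr_suml; apply/eqP; rewrite mulf_eq0; apply/orP; left.
  have q1 : w ^- r - 1 != 0.
    rewrite subr_eq0 -(inj_eq invr_inj) invrK invr1 -(prim_order_dvd prim_w).
    by rewrite gtnNdvd // lt0n.
  rewrite -(mulrI_eq0 _ (mulfI q1)).
  under eq_bigr do rewrite /c mulnC exprM -exprVn.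
  by rewrite -subrX1 exprVn exprAC wN expr1n invr1 subrr.
have [k gk|g0] := pickP (fun k : 'I_N => g k x0 != 0); last first.
  have /eqP := sum_g; rewrite big1 => [|k _]; last first.
    by apply/eqP; rewrite -[_ == _]negbK g0.
  by rewrite eq_sym mulf_eq0 (negPf fx0) orbF pnatr_eq0 eqn0Ngt N_gt0.
exists k, (c k), (g k); split=> // [y|x].
  rewrite /g exchange_big mulr_sumr; apply: eq_bigr => r _ /=.
  by rewrite -mulr_sumr mulrCA -fE; under eq_bigr do rewrite -mulgA.
pose h r := c k r * f (x * t ^+ r)%g.
(* The summands at [N] and 0 agree, so moving the index by one leaves the sum unchanged; translation
   by [t] does just this, up to the factor [w^k]. *)
have hN : h N = h 0 by rewrite /h /c tN expg0 mulnC exprM wN expr1n muln0.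
have shift : \sum_(r < N) h r.+1 = \sum_(r < N) h r.
  apply: (addrI (h 0)); transitivity (\sum_(r < N.+1) h r).
    by rewrite big_ord_recl.
  by rewrite big_ord_recr /= hN addrC.
rewrite /g -[X in _ = _ * X]shift mulr_sumr; apply: eq_bigr => r _.
rewrite /h /c mulnS exprD invfM !mulrA divff ?expf_neq0 // mul1r.
by rewrite -mulgA -expgS.
Qed.

End CayleyEigenfunctions.

(** * Primitive roots of unity from the complex exponential *)

Section RootsOfUnity.
Import Order.TTheory GRing.Theory Num.Theory.
Local Open Scope ring_scope.
Variable R : realType.
Local Notation C := R[i]%C.

Lemma expiX (t : R) m : expi t ^+ m = expi (t *+ m).
Proof.
elim: m => [|m IHm]; first by rewrite /expi cos0 sin0.
rewrite exprS IHm mulrS /expi cosD sinD; apply/eqP; rewrite eq_complex /=.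
by rewrite eqxx /= addrC.
Qed.

Lemma expi_pi : expi (pi : R) = -1.
Proof. by rewrite /expi cospi sinpi; apply/eqP; rewrite eq_complex /= oppr0 !eqxx. Qed.

Lemma xiXn n : (0 < n)%N -> xi R n ^+ n = -1.
Proof.
move=> n_gt0; rewrite expiX -(mulr_natr (pi / n%:R)) divfK ?expi_pi //.
by rewrite pnatr_eq0 -lt0n.
Qed.

(** [xi^m] is not real for [0 < m < n], as [sin (pi m / n) > 0]; exponents between [n] and [2n]
    reduce to these by [xi^n = -1]. *)
Lemma xi_prim n : (0 < n)%N -> (2 * n).-primitive_root (xi R n).
Proof.
move=> n_gt0; have nR : (n%:R : R) != 0 by rewrite pnatr_eq0 -lt0n.
have small m : (0 < m < n)%N -> xi R n ^+ m != 1 /\ xi R n ^+ m != -1.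
  case/andP=> m_gt0 ltmn; rewrite expiX.
  have: 0 < sin (pi / n%:R *+ m : R).
    apply: sin_gt0_pi; rewrite pmulrn_lgt0 // divr_gt0 ?pi_gt0 ?ltr0n //=.
    rewrite -(mulr_natr (pi / n%:R)) mulrAC ltr_pdivrMr ?ltr0n // ltr_pM2l ?pi_gt0 //.
    by rewrite ltr_nat.
  by split; apply/eqP => -[_ s0]; rewrite s0 ?oppr0 ltxx in H.
apply/andP; split; first by rewrite muln_gt0.
apply/forallP => m; rewrite unity_rootE; apply/eqP.
case: (ltngtP m.+1 (2 * n)) (ltn_ord m) => // [lt_m2n _|-> _]; last first.
  by rewrite mulnC exprM xiXn // sqrrN expr1n eqxx.
case: (ltngtP m.+1 n) => [ltmn|ltnm|->]; last 1 first.
- rewrite xiXn // eqr_oppLR -subr_eq0 opprK; apply/negbTE.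
  by rewrite -(natrD _ 1 1) pnatr_eq0.
- by apply/negbTE; case: (small m.+1) => //; rewrite ltmn.
rewrite -(subnK (ltnW ltnm)) exprD xiXn // mulrN1 eqr_oppLR; apply/negbTE.
have lt_sub : (0 < m.+1 - n < n)%N.
  by rewrite subn_gt0 ltnm ltn_subLR ?addnn -?mul2n // ltnW.
by have [] := small _ lt_sub.
Qed.

Lemma epsilonE n : epsilon R n = xi R n ^+ 2.
Proof. by rewrite expiX /epsilon -mulrA mulr_natl. Qed.

Lemma xi2E : xi R 2 = 'i%C.
Proof. by rewrite /xi /expi cos_pihalf sin_pihalf. Qed.

End RootsOfUnity.

(** * Two-dimensional induced representations and their characters *)

Section InducedRepresentation.
Import GRing.Theory Num.Theory.
Local Open Scope ring_scope.
Variables (F : fieldType) (zeta gamma : F).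

(* The representation induced from the character a |-> zeta, b^2 |-> gamma of
   the index 2 subgroup generated by a and b^2. *)
Definition ind_a : 'M[F]_2 :=
  \matrix_(i, j) (if i != j then 0 else if i == 0 then zeta else zeta^-1).
Definition ind_b : 'M[F]_2 :=
  \matrix_(i, j) (if i == j then 0 else if i == 0 then gamma else 1).

Lemma ind_aX r :
  ind_a ^+ r = \matrix_(i, j)
    (if i != j then 0 else if i == 0 then zeta ^+ r else zeta ^- r).
Proof.
elim: r => [|r IHr]; first by apply: matrix22P; rewrite !mxE //= invr1.
by rewrite exprSr {}IHr -mulmxE; apply: matrix22P; rewrite !mulmx22 !mxE /=;
  rewrite ?mulr0 ?mul0r ?addr0 ?add0r // -?invfM -?exprSr.
Qed.

Lemma ind_b2 : ind_b ^+ 2 = gamma%:M.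
Proof.
by rewrite expr2 -mulmxE; apply: matrix22P; rewrite !mulmx22 !mxE /=;
  rewrite ?mulr0 ?mul0r ?mulr1 ?mul1r ?addr0 ?add0r.
Qed.

Lemma ind_aba : zeta != 0 -> ind_a * ind_b * ind_a = ind_b.
Proof.
move=> z_neq0; rewrite -!mulmxE; apply: matrix22P; rewrite !mulmx22 !mxE /=;
  rewrite ?(mulr0, mul0r, addr0, add0r, mulr1, mulVf) //.
by rewrite mulrAC divff ?mul1r.
Qed.

Variables (n : nat) (gT : finGroupType) (a b : gT).
Hypotheses (n_gt0 : (0 < n)%N) (T8n_ab : is_T8n n a b).
Hypotheses (zeta_gamma : zeta ^+ n = gamma ^+ 2) (gamma4 : gamma ^+ 4 = 1).

Definition ind_rep : gT -> 'M[F]_2 := T8n_ext n a b ind_a ind_b.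

Let zeta2n : zeta ^+ (2 * n) = 1.
Proof. by rewrite mulnC exprM zeta_gamma -exprM. Qed.

Lemma zeta_neq0 : zeta != 0.
Proof.
apply/eqP => z0; move/eqP: zeta2n; rewrite z0 expr0n eqn0Ngt muln_gt0 n_gt0.
by rewrite eq_sym oner_eq0.
Qed.

Let a2n : ind_a ^+ (2 * n) = 1.
Proof. by rewrite ind_aX zeta2n; apply: matrix22P; rewrite !mxE //= invr1. Qed.

Let anb4 : ind_a ^+ n = ind_b ^+ 4.
Proof.
rewrite ind_aX (exprM _ 2 2) ind_b2 zeta_gamma (expr2 gamma%:M) -mulmxE -scalar_mxM.
apply: matrix22P; rewrite !mxE //= -expr2.
(* The lower diagonal entries are [gamma^-2] and [gamma^2]; they agree by [gamma^4 = 1]. *)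
apply: (mulfI (x := gamma ^+ 2)); rewrite -?exprD ?gamma4 ?divff //;
  by rewrite -zeta_gamma expf_neq0 ?zeta_neq0.
Qed.

Let aba : ind_a * ind_b * ind_a = ind_b := ind_aba zeta_neq0.

Lemma ind_repE r s : ind_rep (a ^+ r * b ^+ s)%g = ind_a ^+ r * ind_b ^+ s.
Proof. exact: (T8n_extE n_gt0 T8n_ab a2n anb4 r s). Qed.

Lemma ind_rep1 : ind_rep 1%g = 1%:M.
Proof. exact: (T8n_ext1 n_gt0 T8n_ab a2n anb4). Qed.

Lemma ind_repM : {morph ind_rep : x y / (x * y)%g >-> x *m y}.
Proof. exact: (T8n_extM n_gt0 T8n_ab a2n anb4 aba). Qed.

Lemma ind_rep_a : ind_rep a = ind_a.
Proof. exact: (T8n_exta n_gt0 T8n_ab a2n anb4). Qed.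

Lemma ind_rep_b : ind_rep b = ind_b.
Proof. exact: (T8n_extb n_gt0 T8n_ab a2n anb4). Qed.

(** The character of [ind_rep] on normal forms. For [s] beyond 3 the catch-all 0 need not be the
    trace, hence the bound in [tr_ind_rep]. *)
Definition ind_char_val (r s : nat) : F :=
  match s with
  | 0 => zeta ^+ r + zeta ^- r
  | 2 => gamma * (zeta ^+ r + zeta ^- r)
  | _ => 0
  end.

Lemma tr_ind_rep r s : (s < 4)%N ->
  \tr (ind_rep (a ^+ r * b ^+ s)%g) = ind_char_val r s.
Proof.
rewrite ind_repE ind_aX mxtrace22 -mulmxE !mulmx22.
have -> : ind_b ^+ s = gamma ^+ (s./2) *: ind_b ^+ odd s.
  rewrite -{1}(odd_double_half s) exprD -mul2n exprM ind_b2.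
  by rewrite -scalemx1 exprZn expr1n -scalerAr mulr1.
by case: s => [|[|[|[|//]]]] _; rewrite /= ?expr0 ?expr1 !mxE /=;
  rewrite ?mulr0 ?mul0r ?mulr1 ?mul1r ?addr0 ?add0r // -mulrDl mulrC.
Qed.

(** [ind_a] and the square of [ind_b] are diagonal; [1 - i] is the other one of the two indices. *)
Lemma ind_rep_even x i :
  x \in (<[a]> :|: <[a]> :* b ^+ 2)%g -> ind_rep x i (1 - i) = 0.
Proof.
have E (M : 'M[F]_2) : M 0 1 = 0 -> M 1 0 = 0 -> M i (1 - i) = 0.
  by case: (ord2P i) => ->; rewrite ?subr0 ?subrr.
rewrite inE => /orP[/cycleP[r ->]|].
  by rewrite -[(a ^+ r)%g]mulg1 (ind_repE r 0) mulr1 ind_aX; apply: E; rewrite !mxE.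
case/rcosetP => _ /cycleP[r ->] ->; rewrite ind_repE ind_b2 ind_aX -mulmxE.
by apply: E; rewrite mulmx22 !mxE /= ?mulr0 ?mul0r ?addr0.
Qed.

Lemma ind_rep_odd x i :
  x \in (<[a]> :* b :|: <[a]> :* b ^+ 3)%g -> ind_rep x i i = 0.
Proof.
have E (M : 'M[F]_2) : M 0 0 = 0 -> M 1 1 = 0 -> M i i = 0.
  by case: (ord2P i) => ->.
rewrite inE => /orP[] /rcosetP[_ /cycleP[r ->] ->].
  rewrite (ind_repE r 1) ind_aX -mulmxE.
  by apply: E; rewrite mulmx22 !mxE /= ?mulr0 ?mul0r ?addr0.
rewrite ind_repE exprSr ind_b2 ind_aX -!mulmxE mul_scalar_mx -scalemxAr.
by apply: E; rewrite mxE mulmx22 !mxE /= ?mulr0 ?mul0r ?addr0 ?mulr0.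
Qed.

End InducedRepresentation.

(** * Separation of even and odd powers of [b] *)

Section Disjoint.
Local Open Scope group_scope.

(** The exponent of [b] in the normal form is unique, hence so is its parity. *)
Lemma T8n_even_odd_disjoint n (gT : finGroupType) (a b : gT) :
  (0 < n)%N -> is_T8n n a b ->
  [disjoint <[a]> :|: <[a]> :* b ^+ 2 & <[a]> :* b :|: <[a]> :* b ^+ 3].
Proof.
move=> n_gt0 T8n_ab; have dn_gt0 : (0 < 2 * n)%N by rewrite muln_gt0.
have same_s r s r' s' : (s < 4)%N -> (s' < 4)%N ->
    a ^+ r * b ^+ s = a ^+ r' * b ^+ s' -> s = s'.
  rewrite -(expg_mod r (T8n_a2n T8n_ab)) -(expg_mod r' (T8n_a2n T8n_ab)) => lts lts'.
  by case/(T8n_uniq n_gt0 T8n_ab (ltn_pmod _ dn_gt0) lts (ltn_pmod _ dn_gt0) lts').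
have evenP x : x \in <[a]> :|: <[a]> :* b ^+ 2 ->
    exists r s, [/\ x = a ^+ r * b ^+ s, (s < 4)%N & ~~ odd s].
  rewrite inE => /orP[/cycleP[r ->]|/rcosetP[_ /cycleP[r ->] ->]].
    by exists r, 0%N; rewrite mulg1.
  by exists r, 2%N.
have oddP x : x \in <[a]> :* b :|: <[a]> :* b ^+ 3 ->
    exists r s, [/\ x = a ^+ r * b ^+ s, (s < 4)%N & odd s].
  rewrite inE => /orP[] /rcosetP[_ /cycleP[r ->] ->]; first by exists r, 1%N.
  by exists r, 3%N.
rewrite -setI_eq0; apply/eqP/setP => x; rewrite [RHS]inE; apply/setIP.
case=> /evenP[r [s [-> lts even_s]]] /oddP[r' [s' [eq_x lts' odd_s']]].
by rewrite (same_s _ _ _ _ lts lts' eq_x) odd_s' in even_s.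
Qed.

End Disjoint.

(** * The spectrum through linear characters and induced representations *)

Section Spectrum.
Import GRing.Theory Num.Theory.
Local Open Scope ring_scope.
Variables (R : realType) (n : nat) (gT : finGroupType) (a b : gT).
Hypotheses (n_gt0 : (0 < n)%N) (T8n_ab : is_T8n n a b).
Local Notation C := R[i]%C.
Local Notation lin_char alpha beta := (T8n_ext n a b (alpha : C) (beta : C)).

Section LinearCharacter.
Variables alpha beta : C.
Hypotheses (alpha2 : alpha ^+ 2 = 1) (alpha_beta : alpha ^+ n = beta ^+ 4).

Let alpha2n : alpha ^+ (2 * n) = 1. Proof. by rewrite exprM alpha2 expr1n. Qed.

Let aba : alpha * beta * alpha = beta.
Proof. by rewrite mulrAC -expr2 alpha2 mul1r. Qed.

Lemma lin_charE r s : lin_char alpha beta (a ^+ r * b ^+ s)%g = alpha ^+ r * beta ^+ s.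
Proof. exact: (T8n_extE n_gt0 T8n_ab alpha2n alpha_beta). Qed.

(** A multiplicative function is itself an eigenfunction: its sum over [S y] is its sum over [S]
    times its value at [y]. *)
Lemma lin_char_eigenvalue (S : {set gT}) :
  eigenvalue (adjmx C (cayley_rel S)) (\sum_(s in S) lin_char alpha beta s).
Proof.
apply/cayley_eigenvalueP; exists (lin_char alpha beta) => [y|].
  rewrite mulr_suml; apply: eq_bigr => s _.
  exact: (T8n_extM n_gt0 T8n_ab alpha2n alpha_beta aba).
by exists 1%g; rewrite (T8n_ext1 n_gt0 T8n_ab alpha2n alpha_beta) oner_eq0.
Qed.

End LinearCharacter.

Lemma translationX (f : gT -> C) t w r :
  (forall x, f (x * t)%g = w * f x) -> forall x, f (x * t ^+ r)%g = w ^+ r * f x.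
Proof.
move=> ft x; elim: r => [|r IHr]; first by rewrite mulg1 mul1r.
by rewrite expgSr mulgA ft IHr exprS mulrA.
Qed.

(** Projecting along [b] keeps the equation for [a]. By normal forms the result is a multiple of a
    linear character, whose sum over [S] must then be [z]. *)
Lemma lin_char_of_eigenfun (S : {set gT}) (z alpha : C) f x0 :
  cayley_eigenfun S z f -> f x0 != 0 -> alpha ^+ 2 = 1 ->
  (forall x, f (x * a)%g = alpha * f x) ->
  exists m, [/\ (m < 8)%N, alpha ^+ n = (omega R ^+ m) ^+ 4
    & z = \sum_(s in S) lin_char alpha (omega R ^+ m) s].
Proof.
move=> fE fx0 alpha2 fa.
have [_ _ [_ b8] anb4 _] := T8n_ab.
have [m [c [g [gdef ltm gx0 gE gb]]]] :=
  translation_eigenfun (@xi_prim R 4 isT) b8 fE fx0.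
rewrite -/(omega R) in gb; set beta := omega R ^+ m in gb.
(* Moving [a] past powers of [b] may invert it, but [a] and its inverse both act by [alpha], as
   [alpha^2 = 1]. *)
have fabX r x : f (x * a * b ^+ r)%g = alpha * f (x * b ^+ r)%g.
  elim: r x => [|r IHr] x; first by rewrite !mulg1 fa.
  rewrite !expgS -!mulgA (mulgA a b) (T8n_ab_comm T8n_ab).
  rewrite -[X in alpha * f (x * (b * X))%g]mul1g -[in RHS](mulVg a) !mulgA.
  by rewrite IHr mulrA -expr2 alpha2 mul1r.
have ga x : g (x * a)%g = alpha * g x.
  rewrite !gdef mulr_sumr; apply: eq_bigr => r _.
  by rewrite fabX mulrCA.
have alpha_beta : alpha ^+ n = beta ^+ 4.
  apply: (mulIf gx0).
  by rewrite -(translationX _ ga) anb4 (translationX _ gb).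
exists m; split=> //; rewrite -/beta.
have gx x : g x = lin_char alpha beta x * g 1%g.
  have [r [s [_ _ ->]]] := T8n_normal_form n_gt0 T8n_ab x.
  rewrite lin_charE // (translationX _ gb) -[X in g X]mul1g (translationX _ ga).
  by rewrite mulrCA mulrA.
have g1 : g 1%g != 0.
  by apply: contraNneq gx0 => g10; rewrite gx g10 mulr0.
apply: (mulIf g1); rewrite mulr_suml -(gE 1%g).
by apply: eq_bigr => s _; rewrite mulg1 -gx.
Qed.

(** [b^2] commutes with [a], so projecting along it keeps the equation for [a]. The resulting [g] is
    determined by [g(1)] and [g(b)], and these two values form the row eigenvector. *)
Lemma ind_rep_of_eigenfun (S : {set gT}) (z zeta : C) f x0 :
  cayley_eigenfun S z f -> f x0 != 0 -> zeta ^+ (2 * n) = 1 ->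
  (forall x, f (x * a)%g = zeta * f x) ->
  exists m, let gamma := 'i%C ^+ m in [/\ (m < 4)%N, zeta ^+ n = gamma ^+ 2
    & eigenvalue (\sum_(s in S) ind_rep zeta gamma n a b s) z].
Proof.
move=> fE fx0 zeta2n fa.
have [_ _ [_ b8] anb4 _] := T8n_ab.
have b24 : ((b ^+ 2) ^+ 4 = 1)%g by rewrite -expgM.
have [m [c [g [gdef ltm gx0 gE gb]]]] :=
  translation_eigenfun (@xi_prim R 2 isT) b24 fE fx0.
rewrite xi2E in gb; set gamma := 'i%C ^+ m in gb.
have gamma4 : gamma ^+ 4 = 1.
  by rewrite exprAC -xi2E (prim_expr_order (@xi_prim R 2 isT)) expr1n.
have ab2 : (commute a (b ^+ 2))%g.
  rewrite /commute !expgS expg0 mulg1 mulgA (T8n_ab_comm T8n_ab) -mulgA.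
  by rewrite -mulgA; congr (_ * _)%g; apply: (mulgI a); rewrite mulKVg
    !mulgA (T8n_ab_comm T8n_ab) mulgKV.
have ga x : g (x * a)%g = zeta * g x.
  rewrite !gdef mulr_sumr; apply: eq_bigr => r _.
  by rewrite -mulgA (commuteX r ab2) mulgA fa mulrCA.
have zeta_gamma : zeta ^+ n = gamma ^+ 2.
  apply: (mulIf gx0).
  by rewrite -(translationX _ ga) anb4 (expgM _ 2 2) (translationX _ gb).
exists m; split=> //; rewrite -/gamma.
set rho := ind_rep zeta gamma n a b.
have rhoM := ind_repM n_gt0 T8n_ab zeta_gamma gamma4; rewrite -/rho in rhoM.
have rho1 := ind_rep1 n_gt0 T8n_ab zeta_gamma gamma4; rewrite -/rho in rho1.
have rho_a := ind_rep_a n_gt0 T8n_ab zeta_gamma gamma4; rewrite -/rho in rho_a.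
have rho_b := ind_rep_b n_gt0 T8n_ab zeta_gamma gamma4; rewrite -/rho in rho_b.
pose u : 'rV[C]_2 := \row_j (if j == 0 then g 1%g else g b).
(* [k] obeys the same equations under [a] and [b^2] as [g] and has the same values at 1 and [b], so
   the two coincide. *)
pose k x := (u *m rho x) 0 0.
have row22 (v : 'rV[C]_2) (M : 'M[C]_2) i :
    (v *m M) 0 i = v 0 0 * M 0 i + v 0 1 * M 1 i.
  by rewrite mxE big_ord_recl big_ord1; congr (_ + v _ _ * M _ i); apply: val_inj.
have ka x : k (x * a)%g = zeta * k x.
  by rewrite /k rhoM mulmxA row22 rho_a !mxE /= mulr0 addr0 mulrC.
have kb x : k (x * b ^+ 2)%g = gamma * k x.
  rewrite /k rhoM mulmxA [(b ^+ 2)%g]expgS expg1 rhoM rho_b.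
  by rewrite -[ind_b _ *m _]/(ind_b _ ^+ 2) ind_b2 mul_mx_scalar mxE.
have k1 : k 1%g = g 1%g by rewrite /k rho1 mulmx1 mxE.
have kb1 : k b = g b.
  by rewrite /k rho_b row22 !mxE /= mulr0 add0r mulr1.
have gk x : g x = k x.
  (* Inverting the normal form of [x^-1] puts the power of [b] first, so that the equations strip
     factors from the right; [7s] and [(2n - 1)r] stand for [-s] and [-r]. *)
  have [r [s [_ _ xE]]] := T8n_normal_form n_gt0 T8n_ab x^-1.
  have -> : (x = b ^+ odd (7 * s) * (b ^+ 2) ^+ (7 * s)./2 * a ^+ ((2 * n).-1 * r))%g.
    rewrite -expgM -expgD mul2n odd_double_half.
    have -> : (b ^+ (7 * s) = b ^- s)%g.
      rewrite expgM -expgVn; congr (_ ^+ _)%g.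
      by apply: (mulgI b); rewrite -expgS b8 mulgV.
    have -> : (a ^+ ((2 * n).-1 * r) = a ^- r)%g.
      rewrite expgM -expgVn; congr (_ ^+ _)%g.
      by apply: (mulgI a); rewrite -expgS prednK ?muln_gt0 // (T8n_a2n T8n_ab) mulgV.
    by rewrite -invMg -xE invgK.
  rewrite (translationX _ ga) (translationX _ gb).
  rewrite (translationX _ ka) (translationX _ kb).
  by case: (odd _); rewrite ?expg1 ?expg0 ?kb1 ?k1.
have u_neq0 : u != 0.
  by apply: contraNneq gx0 => u0; rewrite gk /k u0 mul0mx mxE.
apply/eigenvalueP; exists u => //.
(* Taking [y = 1] and [y = b] gives the two coordinates of the eigenvector equation for [u]. *)
have kE y : ((u *m (\sum_(s in S) rho s)) *m rho y) 0 0 = z * k y.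
  rewrite -gk -gE mulmx_sumr mulmx_suml summxE.
  by apply: eq_bigr => s _; rewrite gk /k rhoM mulmxA.
apply/rowP => i; case: (ord2P i) => ->.
  by have := kE 1%g; rewrite rho1 mulmx1 k1 !mxE.
by have := kE b; rewrite rho_b row22 kb1 !mxE /= mulr0 add0r mulr1.
Qed.

Lemma cayley_eigenvalue_cases (S : {set gT}) z :
  eigenvalue (adjmx C (cayley_rel S)) z ->
  exists2 k, (k < 2 * n)%N & let zeta := xi R n ^+ k in
  (exists m, [/\ (m < 8)%N, zeta ^+ 2 = 1, zeta ^+ n = (omega R ^+ m) ^+ 4
    & z = \sum_(s in S) lin_char zeta (omega R ^+ m) s]) \/
  (exists m, [/\ (m < 4)%N, zeta ^+ 2 != 1, zeta ^+ n = ('i%C ^+ m) ^+ 2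
    & eigenvalue (\sum_(s in S) ind_rep zeta ('i%C ^+ m) n a b s) z]).
Proof.
case/cayley_eigenvalueP => f fE [x0 fx0].
have prim_xi := xi_prim R n_gt0.
have [k [c [g [_ ltk gx0 gE ga]]]] :=
  translation_eigenfun prim_xi (T8n_a2n T8n_ab) fE fx0.
exists k => //; set zeta := xi R n ^+ k in ga *.
have zeta2n : zeta ^+ (2 * n) = 1 by rewrite exprAC (prim_expr_order prim_xi) expr1n.
have [zeta2|zeta2] := eqVneq (zeta ^+ 2) 1; [left|right].
  have [m [ltm zm zE]] := lin_char_of_eigenfun gE gx0 zeta2 ga.
  by exists m.
have [m [ltm zm zE]] := ind_rep_of_eigenfun gE gx0 zeta2n ga.
by exists m.
Qed.

End Spectrum.

(** * Matching the tabulated characters with linear and induced ones *)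

Section CharacterValues.
Import GRing.Theory Num.Theory.
Local Open Scope ring_scope.
Variables (R : realType) (n : nat).
Hypothesis n_gt0 : (0 < n)%N.
Local Notation C := R[i]%C.
Local Notation xi := (xi R n).
Local Notation omega := (omega R).

Lemma xi_neq0 : xi != 0.
Proof. by rewrite (prim_root_eq0 (xi_prim R n_gt0)) -lt0n muln_gt0. Qed.

Lemma xi2n : xi ^+ (2 * n) = 1.
Proof. exact: prim_expr_order (xi_prim R n_gt0). Qed.

Lemma xiXXn k : (xi ^+ k) ^+ n = (-1) ^+ k.
Proof. by rewrite exprAC xiXn. Qed.

Lemma omega4 : omega ^+ 4 = -1.
Proof. exact: (@xiXn R 4). Qed.

Definition chi_a (j : nat) : C := (-1) ^+ j.
Definition chi_b (j : nat) : C :=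
  if odd n then omega ^+ j else if odd j then omega ^+ (j - 1) else omega ^+ j.

Lemma chi_valE j r s : chi_val R n j r s = chi_a j ^+ r * chi_b j ^+ s.
Proof.
rewrite /chi_val /chi_a /chi_b; case: (odd n).
  by rewrite mulnC exprM [(s * j)%N]mulnC exprM.
rewrite -(signr_odd _ j).
by case: (odd j); rewrite ?expr1 ?expr1n ?mul1r [(s * _)%N]mulnC exprM.
Qed.

Lemma chi_a2 j : chi_a j ^+ 2 = 1.
Proof. by rewrite /chi_a exprAC sqrrN expr1n expr1n. Qed.

Lemma chi_ab j : chi_a j ^+ n = chi_b j ^+ 4.
Proof.
rewrite /chi_a /chi_b; case: ifP => odd_n.
  by rewrite [RHS]exprAC omega4 exprAC -signr_odd odd_n expr1.
have -> : ((-1) ^+ j) ^+ n = 1 :> C.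
  by rewrite exprAC -signr_odd odd_n expr1n.
case: ifP => odd_j; rewrite exprAC omega4 -signr_odd ?odd_j //.
by rewrite oddB ?odd_j //; case: j odd_j.
Qed.

(** The last condition says that [k] and [m] have the same parity. Hence [xi^k = 1] forces [m] even,
    and [xi^k = -1] forces [m] to have the parity of [n]. *)
Lemma chi_of_pair k m : (m < 8)%N -> (xi ^+ k) ^+ 2 = 1 ->
  (xi ^+ k) ^+ n = (omega ^+ m) ^+ 4 ->
  exists2 j, (j < 8)%N & chi_a j = xi ^+ k /\ chi_b j = omega ^+ m.
Proof.
move=> ltm zeta2; rewrite xiXXn [RHS]exprAC omega4 => km.
have odd_km : odd k = odd m.
  move/eqP: km; rewrite -signr_odd -[X in _ == X]signr_odd.
  by rewrite (inj_eq (@signr_inj C)) => /eqP.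
have [zeta1|zeta1] : (xi ^+ k = 1) \/ (xi ^+ k = -1).
- by move/eqP: zeta2; rewrite sqrf_eq1 => /orP[] /eqP; [left|right].
- have k0 : (-1) ^+ k = 1 :> C by rewrite -xiXXn zeta1 expr1n.
  have odd_m : odd m = false.
    move/eqP: k0; rewrite -signr_odd -(expr0 (-1)) -[0%N]/(nat_of_bool false).
    by rewrite (inj_eq (@signr_inj C)) -odd_km => /eqP.
  exists m => //; rewrite /chi_a /chi_b zeta1 -signr_odd odd_m.
  by case: (odd n).
have kn : (-1) ^+ k = (-1) ^+ n :> C by rewrite -xiXXn zeta1.
have odd_mn : odd m = odd n.
  move/eqP: kn; rewrite -signr_odd -[X in _ == X]signr_odd.
  by rewrite (inj_eq (@signr_inj C)) -odd_km => /eqP.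
case odd_n: (odd n) odd_mn => odd_m.
  exists m => //; rewrite /chi_a /chi_b odd_n zeta1 -signr_odd odd_m expr1.
  by split.
(* For even [n], [chi_b] lowers an odd index by one, hence [m + 1]; this stays below 8 because [m]
   is even. *)
exists m.+1; last by rewrite /chi_a /chi_b odd_n -signr_odd /= odd_m zeta1 expr1 subn1.
by rewrite ltn_neqAle ltm andbT; apply: contraFneq odd_m => -[->].
Qed.

(** These four functions give the parameters [zeta] and [gamma] for which [ind_char_val] reproduces
    the tables of [phi] and [psi]. *)
Definition phi_a (k : nat) : C := if odd n then epsilon R n ^+ k else xi ^+ k.
Definition phi_b2 (k : nat) : C :=
  if odd n then (-1) ^+ k else if odd k then 'i%C else 1.
Definition psi_a (h : nat) : C :=
  if odd n then (-1) ^+ h.+1 * xi ^+ h else xi ^+ h.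
Definition psi_b2 (h : nat) : C :=
  if odd n then 'i%C else if odd h then - 'i%C else -1.

Lemma phi_valE k r s : (s < 4)%N ->
  phi_val R n k r s = ind_char_val (phi_a k) (phi_b2 k) r s.
Proof.
rewrite /phi_val /phi_a /phi_b2; case: (odd n);
  case: s => [|[|[|[|//]]]] _ //=; rewrite -!exprM //.
by case: (odd k); rewrite ?mul1r.
Qed.

Lemma psi_valE h r s : (s < 4)%N ->
  psi_val R n h r s = ind_char_val (psi_a h) (psi_b2 h) r s.
Proof.
rewrite /psi_val /psi_a /psi_b2; case: (odd n); last first.
  case: s => [|[|[|[|//]]]] _ //=; rewrite -!exprM //.
  by case: (odd h); rewrite ?mulN1r.
have E : ((-1) ^+ h.+1 * xi ^+ h) ^+ r = (-1) ^+ (r * h + r) * xi ^+ (h * r).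
  by rewrite exprMn -!exprM mulSn addnC mulnC.
have {}E : ((-1) ^+ h.+1 * xi ^+ h) ^+ r + ((-1) ^+ h.+1 * xi ^+ h) ^- r =
    (-1) ^+ (r * h + r) * (xi ^+ (h * r) + xi ^- (h * r)).
  by rewrite E invfM invr_sign mulrDr.
by case: s => [|[|[|[|//]]]] _ //=; rewrite E ?mulrA.
Qed.

Lemma phi_ab k : phi_a k ^+ n = phi_b2 k ^+ 2.
Proof.
rewrite /phi_a /phi_b2; case: (odd n).
  by rewrite epsilonE -!exprM mulnA mulnAC exprM xi2n expr1n mulnC exprM sqrrN !expr1n.
rewrite xiXXn -signr_odd; case: (odd k); last by rewrite expr1n.
by rewrite expr1 sqr_i.
Qed.

Lemma psi_ab h : psi_a h ^+ n = psi_b2 h ^+ 2.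
Proof.
rewrite /psi_a /psi_b2; case: ifP => odd_n.
  rewrite exprMn xiXXn [X in X * _]exprAC -(signr_odd _ n) odd_n expr1.
  by rewrite exprSr mulrAC -expr2 exprAC sqrrN expr1n expr1n mul1r sqr_i.
rewrite xiXXn -signr_odd; case: (odd h); last by rewrite sqrrN expr1n.
by rewrite expr1 sqrrN sqr_i.
Qed.

Lemma phi_b24 k : phi_b2 k ^+ 4 = 1.
Proof.
rewrite /phi_b2; case: (odd n).
  by rewrite exprAC (exprM _ 2 2) sqrrN !expr1n.
case: (odd k); last by rewrite expr1n.
by rewrite (exprM _ 2 2) sqr_i sqrrN expr1n.
Qed.

Lemma psi_b24 k : psi_b2 k ^+ 4 = 1.
Proof.
by rewrite /psi_b2; case: (odd n); last case: (odd k);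
  rewrite (exprM _ 2 2) ?sqrrN ?expr1n ?sqr_i ?sqrrN ?expr1n.
Qed.

Lemma ind_char_valV (zeta gamma : C) r s :
  ind_char_val zeta^-1 gamma r s = ind_char_val zeta gamma r s.
Proof.
by rewrite /ind_char_val exprVn invrK addrC.
Qed.

Lemma conjc_xi : conjc xi = xi^-1.
Proof.
apply: (mulfI xi_neq0); rewrite divff ?xi_neq0 // /Defs.xi /expi.
apply/eqP; rewrite eq_complex /=; apply/andP; split; apply/eqP; last by ring.
by rewrite -[RHS](cos2Dsin2 (pi / n%:R)); ring.
Qed.

(** [xi] lies on the unit circle, so [zeta^r + zeta^-r] is real for [zeta = xi^k] and conjugation
    affects [gamma] only. *)
Lemma ind_char_val_conj k gamma r s :
  ind_char_val (xi ^+ k) (conjc gamma) r s = conjc (ind_char_val (xi ^+ k) gamma r s).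
Proof.
have E : conjc (xi ^+ k ^+ r + (xi ^+ k) ^- r) = xi ^+ k ^+ r + (xi ^+ k) ^- r.
  have EX : conjc (xi ^+ k ^+ r) = (xi ^+ k) ^- r.
    by rewrite -!exprM -exprVn -conjc_xi; exact: rmorphXn.
  transitivity (conjc (xi ^+ k ^+ r) + conjc ((xi ^+ k) ^- r)); first exact: rmorphD.
  by rewrite conjc_inv EX invrK addrC.
have conj0 : 0 = conjc (0 : C) by rewrite conjc0.
case: s => [|[|[|s]]]; [exact: (esym E) | exact: conj0 | | exact: conj0].
by rewrite /ind_char_val -[in LHS]E; symmetry; exact: rmorphM.
Qed.

(* For odd n the psi_h only realise gamma = i; the characters with gamma = -i
   are their complex conjugates. *)
Lemma phi_psi_of_pair k m : (k < 2 * n)%N -> (m < 4)%N -> (xi ^+ k) ^+ 2 != 1 ->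
  (xi ^+ k) ^+ n = ('i%C ^+ m) ^+ 2 ->
  exists2 l, (0 < l < n)%N & let v := ind_char_val (xi ^+ k) ('i%C ^+ m) in
  [\/ v =2 ind_char_val (phi_a l) (phi_b2 l),
      v =2 ind_char_val (psi_a l) (psi_b2 l)
    | v =2 fun r s => conjc (ind_char_val (psi_a l) (psi_b2 l) r s)].
Proof.
move=> ltk ltm zeta2; rewrite xiXXn [RHS]exprAC sqr_i => km.
have odd_km : odd k = odd m.
  move/eqP: km; rewrite -signr_odd -[X in _ == X]signr_odd.
  by rewrite (inj_eq (@signr_inj C)) => /eqP.
have k_neq0 : k != 0%N by apply: contraNneq zeta2 => ->; rewrite expr1n.
have k_neqn : k != n by apply: contraNneq zeta2 => ->; rewrite xiXn // sqrrN expr1n.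
(* If [k > n], passing to [2n - k] inverts [xi^k], which changes neither the character nor the
   parity. *)
have [k' /andP[k'_gt0 ltk'] [odd_k' vE]] : exists2 k', (0 < k' < n)%N &
    odd k' = odd k /\ forall gamma r s,
      ind_char_val (xi ^+ k) gamma r s = ind_char_val (xi ^+ k') gamma r s.
  case: (ltngtP k n) k_neqn => // [ltkn|ltnk] _.
    by exists k; rewrite ?lt0n ?k_neq0.
  exists (2 * n - k)%N.
    by lia.
  split=> [|gamma r s]; first by rewrite oddB 1?ltnW // oddM.
  rewrite -ind_char_valV; congr ind_char_val.
  apply: (mulIf (expf_neq0 k xi_neq0)); rewrite mulVf ?expf_neq0 ?xi_neq0 //.
  by rewrite -exprD subnK 1?ltnW // xi2n.
case odd_n: (odd n); last first.
  (* For even [n] the index is [k']: [phi] covers [gamma = 1, i] and [psi] covers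
     [gamma = -1, -i]. *)
  exists k'; rewrite ?k'_gt0 //.
  rewrite /phi_a /phi_b2 /psi_a /psi_b2 odd_n odd_k' odd_km.
  case: m {km odd_km} ltm => [|[|[|[|//]]]] _ /=.
  - by constructor 1 => r s; rewrite vE expr0.
  - by constructor 1 => r s; rewrite vE expr1.
  - by constructor 2 => r s; rewrite vE sqr_i.
  by constructor 2 => r s; rewrite vE exprS sqr_i mulrN1.
case odd_m: (odd m) odd_km => odd_k; rewrite odd_k in odd_k'.
  exists k'; rewrite ?k'_gt0 //.
  have psi_k' : psi_a k' = xi ^+ k'.
    by rewrite /psi_a odd_n -signr_odd /= odd_k' expr0 mul1r.
  rewrite /= psi_k' /psi_b2 odd_n.
  case: m {km} odd_m ltm => [|[|[|[|//]]]] // _ _ /=.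
    by constructor 2 => r s; rewrite vE expr1.
  constructor 3 => r s; rewrite vE exprS sqr_i mulrN1 -ind_char_val_conj.
  by congr ind_char_val; apply/eqP; rewrite eq_complex /= oppr0 !eqxx.
pose l := k'./2; have k'E : k' = (2 * l)%N by rewrite mul2n -[LHS]odd_double_half odd_k'.
have l_gt0 : (0 < l)%N by rewrite k'E muln_gt0 in k'_gt0.
have ltl : (l < n)%N by apply: leq_trans ltk'; rewrite ltnS k'E mul2n -addnn leq_addr.
have phi_l : phi_a l = xi ^+ k' by rewrite /phi_a odd_n epsilonE -exprM -k'E.
have phi_nl : phi_a (n - l) = (xi ^+ k')^-1.
  rewrite -phi_l /phi_a odd_n epsilonE.
  apply: (mulIf (expf_neq0 l (expf_neq0 2 xi_neq0))).
  by rewrite -exprD subnK 1?ltnW // mulVf ?expf_neq0 ?xi_neq0 // -exprM xi2n.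
(* [phi_b2] is [(-1)^l'] here, so the index must be odd exactly when [m = 2]. If [l] has the wrong
   parity, [n - l] has the right one, [n] being odd, and merely inverts [zeta]. *)
have [l' ltl' [l'E odd_l']] : exists2 l', (0 < l' < n)%N &
    (phi_a l' = xi ^+ k' \/ phi_a l' = (xi ^+ k')^-1) /\ odd l' = (1 < m)%N.
  have [odd_l|odd_l] := eqVneq (odd l) (1 < m)%N.
    by exists l; rewrite ?l_gt0; auto.
  exists (n - l)%N; first by lia.
  split; first by right.
  by rewrite oddB ?(ltnW ltl) // odd_n; move: odd_l; case: (odd l); case: (1 < m)%N.
exists l' => //; constructor 1 => r s; rewrite vE.
have -> : 'i%C ^+ m = phi_b2 l'.
  rewrite /phi_b2 odd_n -signr_odd odd_l'.
  by case: m odd_m ltm {km odd_l'} => [|[|[|[|//]]]] //= _ _; rewrite ?expr0 ?sqr_i.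
by case: l'E => ->; rewrite ?ind_char_valV.
Qed.

End CharacterValues.

(** * The integrality criterion in terms of character sums *)

Section Conditions.
Import GRing.Theory Num.Theory.
Local Open Scope ring_scope.
Variables (R : realType) (n : nat) (gT : finGroupType) (a b : gT).
Hypotheses (n_gt0 : (0 < n)%N) (T8n_ab : is_T8n n a b).
Local Notation C := R[i]%C.
Variables S S1 S2 : {set gT}.
Hypotheses (defS : S = S1 :|: S2)
  (S1_even : S1 \subset (<[a]> :|: <[a]> :* b ^+ 2)%g)
  (S2_odd : S2 \subset (<[a]> :* b :|: <[a]> :* b ^+ 3)%g).

Definition integral_conditions (f : gT -> C) : Prop :=
  [/\ is_integer (char_sum f S1), is_integer (sq_sum f S1 S2)
    & is_perfect_square (Delta f S1 S2)].

Lemma eq_integral_conditions f g : f =1 g ->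
  integral_conditions f -> integral_conditions g.
Proof.
move=> fg; have fgS : char_sum f S1 = char_sum g S1 by apply: eq_bigr => x _.
have fg2 A : char_sum2 f A A = char_sum2 g A A.
  by apply: eq_bigr => x _; apply: eq_bigr => y _.
by rewrite /integral_conditions /Delta /sq_sum !fg2 fgS.
Qed.

(** Sums of conjugate values are conjugate, and integers are real. This handles the characters that
    occur only as conjugates of some [psi]. *)
Lemma integral_conditions_conj f :
  integral_conditions f -> integral_conditions (fun x => conjc (f x)).
Proof.
have conj_int (m : int) : conjc (m%:~R : C) = m%:~R by exact: (rmorph_int (@conjc R)).
have S1E : char_sum (fun x => conjc (f x)) S1 = conjc (char_sum f S1).
  by symmetry; exact: rmorph_sum.
have S2E A : char_sum2 (fun x => conjc (f x)) A A = conjc (char_sum2 f A A).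
  symmetry; rewrite [LHS]rmorph_sum; apply: eq_bigr => x _; exact: rmorph_sum.
have sqE : sq_sum (fun x => conjc (f x)) S1 S2 = conjc (sq_sum f S1 S2).
  by rewrite /sq_sum !S2E; symmetry; exact: rmorphD.
rewrite /integral_conditions /Delta sqE S1E.
case=> -[m mE] [p pE]; rewrite mE pE !conj_int => sq.
by split=> //; [exists m | exists p].
Qed.

Lemma on_normal_formE (v : nat -> nat -> C) (f : gT -> C) :
  (forall r s, (s < 4)%N -> v r s = f (a ^+ r * b ^+ s)%g) ->
  on_normal_form n a b v =1 f.
Proof.
move=> vf x; rewrite /on_normal_form; case: pickP => [p /eqP -> |]; first exact: vf.
have [r [s [ltr lts ->]]] := T8n_normal_form n_gt0 T8n_ab x.
by move/(_ (Ordinal ltr, Ordinal lts)); rewrite eqxx.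
Qed.

Lemma chiE j : chi R n a b j =1 T8n_ext n a b (chi_a R j) (chi_b R n j).
Proof.
apply: on_normal_formE => r s _.
by rewrite chi_valE (lin_charE n_gt0 T8n_ab (chi_a2 R j) (chi_ab R n j)).
Qed.

Section Induced.
Variables zeta gamma : C.
Hypotheses (zeta_gamma : zeta ^+ n = gamma ^+ 2) (gamma4 : gamma ^+ 4 = 1).

Local Notation rho := (ind_rep zeta gamma n a b).
Let rhoM := ind_repM n_gt0 T8n_ab zeta_gamma gamma4.

Lemma ind_rep_integral :
  integral_conditions (fun x => \tr (rho x)) <->
  (forall z, eigenvalue (\sum_(s in S) rho s) z -> is_integer z).
Proof.
pose M1 := \sum_(s in S1) rho s; pose M2 := \sum_(s in S2) rho s.
have -> : \sum_(s in S) rho s = M1 + M2.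
  rewrite -bigU /=; first by apply: eq_bigl => x; rewrite defS inE.
  apply: disjointWl S1_even _; apply: disjointWr S2_odd _.
  exact: T8n_even_odd_disjoint n_gt0 T8n_ab.
have M1_diag i : M1 i (1 - i) = 0.
  rewrite summxE big1 // => s /(subsetP S1_even).
  exact: (ind_rep_even n_gt0 T8n_ab zeta_gamma gamma4).
have M2_diag i : M2 i i = 0.
  rewrite summxE big1 // => s /(subsetP S2_odd).
  exact: (ind_rep_odd n_gt0 T8n_ab zeta_gamma gamma4).
have [M01 M10] : M1 0 1 = 0 /\ M1 1 0 = 0.
  by have := M1_diag 0; have := M1_diag 1; rewrite subr0 subrr.
have tr_sq (A : {set gT}) : char_sum2 (fun x => \tr (rho x)) A A =
    \tr ((\sum_(s in A) rho s) *m (\sum_(s in A) rho s)).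
  rewrite mulmx_suml linear_sum; apply: eq_bigr => x _.
  rewrite mulmx_sumr linear_sum; apply: eq_bigr => y _.
  by rewrite rhoM.
have trM : char_sum (fun x => \tr (rho x)) S1 = \tr (M1 + M2).
  rewrite [RHS]linearD /= [X in _ + X]mxtrace22 !M2_diag !addr0.
  by rewrite [RHS]linear_sum.
(* [M1] is diagonal and [M2] antidiagonal, so [M1 M2] and [M2 M1] have zero trace. *)
have trM2 : sq_sum (fun x => \tr (rho x)) S1 S2 = \tr ((M1 + M2) *m (M1 + M2)).
  have addE i j : (M1 + M2) i j = M1 i j + M2 i j by rewrite mxE.
  rewrite /sq_sum !tr_sq -/M1 -/M2 !mxtrace22 !mulmx22 !addE M01 M10 !M2_diag.
  by ring.
rewrite eigenvalues22_integer /integral_conditions /Delta trM trM2.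
by [].
Qed.

Lemma on_normal_form_ind : on_normal_form n a b (ind_char_val zeta gamma) =1
  (fun x => \tr (rho x)).
Proof.
by apply: on_normal_formE => r s lts; rewrite (tr_ind_rep n_gt0 T8n_ab).
Qed.

Lemma integral_graph_ind (v : nat -> nat -> C) :
  (forall r s, (s < 4)%N -> v r s = ind_char_val zeta gamma r s) ->
  integral_graph R (cayley_rel S) -> integral_conditions (on_normal_form n a b v).
Proof.
move=> vE intS; apply: (@eq_integral_conditions (fun x => \tr (rho x))).
  apply: fsym; apply: on_normal_formE => r s lts.
  by rewrite vE ?(tr_ind_rep n_gt0 T8n_ab).
apply/ind_rep_integral => z zE; apply: intS.
exact: (hom_eigenfun (ind_rep1 n_gt0 T8n_ab zeta_gamma gamma4) rhoM zE).
Qed.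

End Induced.

Lemma integral_iff_conditions :
  integral_graph R (cayley_rel S) <->
  [/\ forall j, (j < 8)%N -> is_integer (char_sum (chi R n a b j) S),
      forall k, (0 < k < n)%N -> integral_conditions (phi R n a b k)
    & forall h, (0 < h < n)%N -> integral_conditions (psi R n a b h)].
Proof.
split=> [intS | [int_chi int_phi int_psi] z].
  split=> [j _ | k _ | h _].
  - have -> : char_sum (chi R n a b j) S =
        \sum_(s in S) T8n_ext n a b (chi_a R j) (chi_b R n j) s.
      by apply: eq_bigr => s _; exact: chiE.
    apply: intS.
    exact: (lin_char_eigenvalue n_gt0 T8n_ab (chi_a2 R j) (chi_ab R n j)).
  - apply: (integral_graph_ind (phi_ab R n_gt0 k) (phi_b24 R n k)) intS => r s.
    exact: phi_valE.
  - apply: (integral_graph_ind (psi_ab R n_gt0 h) (psi_b24 R n h)) intS => r s.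
    exact: psi_valE.
case/(cayley_eigenvalue_cases n_gt0 T8n_ab) => k ltk [] [m [ltm]] /=.
  move=> zeta2 zeta_n ->.
  have [j ltj [jE1 jE2]] := chi_of_pair n_gt0 ltm zeta2 zeta_n.
  have := int_chi j ltj; rewrite -jE1 -jE2.
  by congr is_integer; apply: eq_bigr => s _; exact: chiE.
move=> zeta2 zeta_gamma.
have gamma4 : ('i%C ^+ m : C) ^+ 4 = 1.
  by rewrite exprAC (exprM _ 2 2) sqr_i sqrrN !expr1n.
(* Integrality of the eigenvalues depends on the character alone, so it suffices to find it, or its
   conjugate, among [phi] and [psi]. *)
apply: (proj1 (ind_rep_integral zeta_gamma gamma4)).
apply: (eq_integral_conditions (on_normal_form_ind zeta_gamma gamma4)).
have eq_onf (v w : nat -> nat -> C) :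
    (forall r s, (s < 4)%N -> v r s = w r s) ->
    on_normal_form n a b v =1 on_normal_form n a b w.
  move=> vw x; rewrite /on_normal_form; case: pickP => // p _; exact: vw.
have [l ltl [] vE] := phi_psi_of_pair n_gt0 ltk ltm zeta2 zeta_gamma.
- apply: eq_integral_conditions (int_phi l ltl); apply: eq_onf => r s lts.
  by rewrite vE phi_valE.
- apply: eq_integral_conditions (int_psi l ltl); apply: eq_onf => r s lts.
  by rewrite vE psi_valE.
apply: eq_integral_conditions (integral_conditions_conj (int_psi l ltl)) => x.
rewrite /psi /on_normal_form; case: pickP => [p _|_]; last exact: conjc0.
by rewrite vE psi_valE.
Qed.

End Conditions.

Theorem theorem3p1 (R : realType) (n : nat) (gT : finGroupType) (a b : gT)
  (S S1 S2 : {set gT}) :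
  (0 < n)%N ->
  is_T8n n a b ->
  S = S1 :|: S2 ->
  S != set0 ->
  (1%g \notin S) ->
  (S^-1)%g = S ->
  S1 \subset (<[a]> :|: <[a]> :* b ^+ 2)%g ->
  S2 \subset (<[a]> :* b :|: <[a]> :* b ^+ 3)%g ->
  integral_graph R (cayley_rel S) <->
  [/\ forall j : nat, (j < 8)%N -> is_integer (char_sum (chi R n a b j) S),
      forall k : nat, (0 < k < n)%N ->
        is_integer (char_sum (phi R n a b k) S1) /\
        is_integer (sq_sum (phi R n a b k) S1 S2),
      forall k : nat, (0 < k < n)%N ->
        is_perfect_square (Delta (phi R n a b k) S1 S2),
      forall h : nat, (0 < h < n)%N ->
        is_integer (char_sum (psi R n a b h) S1) /\
        is_integer (sq_sum (psi R n a b h) S1 S2)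
    & forall h : nat, (0 < h < n)%N ->
        is_perfect_square (Delta (psi R n a b h) S1 S2)].
Proof.
move=> n_gt0 T8n_ab defS _ _ _ S1_even S2_odd.
rewrite (integral_iff_conditions R n_gt0 T8n_ab defS S1_even S2_odd).
split=> [[int_chi int_phi int_psi] | [int_chi int_phi sq_phi int_psi sq_psi]].
  by split=> // k ltk; [case: (int_phi k ltk) | case: (int_phi k ltk)
    | case: (int_psi k ltk) | case: (int_psi k ltk)].
split=> // k ltk; split; [by case: (int_phi k ltk) | by case: (int_phi k ltk)
  | exact: sq_phi | by case: (int_psi k ltk) | by case: (int_psi k ltk) | exact: sq_psi].
Qed.
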